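(* Let $\mathcal K\subset\mathbb R^n$ be a polytope, $q$ a differentiable convex function on $\mathbb R^n$, and $\phi$ a $\nu$-self-concordant barrier over $\mathcal K$. Assume that there are a point $\bar x$ and $r,R>0$ with $\mathcal B(\bar x,r)\subseteq\mathcal K\subseteq\mathcal B(\bar x,R)$. For arbitrary $\eta>0$, let $x^\eta:=\arg\min_x q(x)+\eta\phi(x)$. Then $$\mathcal B\left(x^\eta,\ \frac rR\min\left\{\frac{\eta}{2\|\nabla q(x^\eta)\|},\ \frac{r}{2\nu+4\sqrt\nu}\right\}\right)\subseteq\mathcal K,$$ where $\frac{\eta}{2\|\nabla q(x^\eta)\|}$ is read as $+\infty$ if $\nabla q(x^\eta)=0$.
   Context: $\mathcal B(x,\rho)$ is the Euclidean ball of radius $\rho$ centered at $x$; $\|\cdot\|$ is the Euclidean norm. A $\nu$-self-concordant barrier on a closed convex set $\mathcal K\subseteq\mathbb R^n$ with nonempty interior is a convex, thrice differentiable function $\phi:\mathrm{int}\,\mathcal K\to\mathbb R$ such that: $\phi(x_i)\to\infty$ along every sequence in $\mathrm{int}\,\mathcal K$ converging to the boundary; $|D^3\phi(x)[h,h,h]|\le2(D^2\phi(x)[h,h])^{3/2}$ for all $x\in\mathrm{int}\,\mathcal K$, $h\in\mathbb R^n$; and $\nabla\phi(x)^\top(\nabla^2\phi(x))^{-1}\nabla\phi(x)\le\nu$ for all $x\in\mathrm{int}\,\mathcal K$, with $\nu\ge1$. The minimization defining $x^\eta$ is over $\mathrm{int}\,\mathcal K$. *)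

(* Defs.v *)
From HB Require Import structures.
From mathcomp Require Import all_boot all_order all_algebra.
From mathcomp Require Import all_classical all_reals all_analysis.
Import Order.TTheory GRing.Theory Num.Theory.
Import numFieldNormedType.Exports.

Set Implicit Arguments.
Unset Strict Implicit.
Unset Printing Implicit Defensive.

Local Open Scope classical_set_scope.
Local Open Scope ring_scope.

(* Vectors of R^n are row vectors.  The library norm `|x| on 'rV[R]_n is the sup norm.  It induces the same
   topology and the same notion of differentiability as the Euclidean norm, but
   not the same balls. *)
Definition enorm (R : realType) (n : nat) (x : 'rV[R]_n) : R :=
  Num.sqrt (\sum_(i < n) x 0 i ^+ 2).

Definition eball (R : realType) (n : nat) (x : 'rV[R]_n) (rho : R) :
    set 'rV[R]_n := closed_ball_ (@enorm R n) x rho.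

(* A bounded intersection of finitely many closed half-spaces. *)
Definition polytope (R : realType) (n : nat) (K : set 'rV[R]_n) : Prop :=
  bounded_set K /\
  exists (m : nat) (A : 'M[R]_(n, m)) (b : 'rV[R]_m),
    K = [set x | forall j : 'I_m, (x *m A) 0 j <= b 0 j].

Definition gradient (R : realType) (n : nat) (f : 'rV[R]_n -> R)
    (x : 'rV[R]_n) : 'rV[R]_n :=
  \row_(i < n) 'D_(delta_mx 0 i) f x.

Definition hessian (R : realType) (n : nat) (f : 'rV[R]_n -> R)
    (x : 'rV[R]_n) : 'M[R]_n := 'J (gradient f) x.

(* D^2 f(x)[h,h] and D^3 f(x)[h,h,h] *)
Definition diff2 (R : realType) (n : nat) (f : 'rV[R]_n -> R)
    (x h : 'rV[R]_n) : R := 'D_h ('D_h f) x.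

Definition diff3 (R : realType) (n : nat) (f : 'rV[R]_n -> R)
    (x h : 'rV[R]_n) : R := 'D_h ('D_h ('D_h f)) x.

Definition thrice_differentiable_at (R : realType) (n : nat)
    (f : 'rV[R]_n -> R) (x : 'rV[R]_n) : Prop :=
  [/\ differentiable f x, differentiable (gradient f) x &
      differentiable (hessian f) x].

Definition topological_boundary (T : topologicalType) (A : set T) : set T :=
  closure A `\` A°.

(* phi is a total function, but only its values on the open set K° matter.
   invmx is junk on singular matrices, so the invertibility of the Hessian that
   the last bound presupposes is spelled out. *)
Record self_concordant_barrier (R : realType) (n : nat) (nu : R)
    (K : set 'rV[R]_n) (phi : 'rV[R]_n -> R) : Prop := {
  scb_closed : closed K ;
  scb_convex_set : convex_set K ;
  scb_interior : K° !=set0 ;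
  scb_nu_ge1 : 1 <= nu ;
  scb_convex : convex_function K° phi ;
  scb_differentiable : forall x, K° x -> thrice_differentiable_at phi x ;
  scb_boundary : forall (u : nat -> 'rV[R]_n) (z : 'rV[R]_n),
    (forall i, K° (u i)) -> topological_boundary K z ->
    u @ \oo --> z -> phi (u i) @[i --> \oo] --> +oo ;
  scb_self_concordant : forall x h, K° x ->
    `|diff3 phi x h| <= 2 * diff2 phi x h `^ (3 / 2) ;
  scb_parameter : forall x, K° x ->
    hessian phi x \in unitmx /\
    (gradient phi x *m invmx (hessian phi x) *m (gradient phi x)^T) 0 0 <= nu
}.

Definition is_argmin (R : realType) (T : Type) (D : set T) (f : T -> R)
    (x : T) : Prop := D x /\ forall y, D y -> f x <= f y.

(* Main.v *)
(* If the ball leaves K, the segment from x = xeta to a point outside K hits the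
   boundary at some z closer to x than the radius; put delta = |z - x|,
   h = xbar - z and beta = delta / r.  By convexity x + s h is interior for
   0 <= s <= 1 + beta, but x - beta h is not.  For f(s) = phi(x + s h),
   self-concordance gives f''(s) >= 1 / (beta + s)^2 (Dikin ellipsoid), and
   f'^2 <= nu f'' gives f'(s) (1 + beta - s) <= nu, since otherwise f' would blow
   up before 1 + beta.  Together, f'(0) <= - 1 / (2 beta) as soon as
   2 beta (nu + 2 sqrt nu) <= 1.  Stationarity of q + eta phi at x turns this into
   r / (2 delta) <= |grad q(x)| Rad / eta, which bounds delta from below. *)

Require Import Defs.
From HB Require Import structures.
From mathcomp Require Import all_boot all_order all_algebra.
From mathcomp Require Import all_classical all_reals all_analysis.
From mathcomp Require Import ring lra.
Import Order.TTheory GRing.Theory Num.Theory.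
Import numFieldNormedType.Exports.

Set Implicit Arguments.
Unset Strict Implicit.
Unset Printing Implicit Defensive.

Local Open Scope classical_set_scope.
Local Open Scope ring_scope.

(** * One-variable calculus: restriction to lines, mean value estimates, differential
    inequalities *)

Lemma is_derive_line {R : realType} {V : normedModType R} (f : V -> R)
    (x h : V) (s d : R) :
  is_derive (x + s *: h) h f d -> is_derive s 1 (fun t => f (x + t *: h)) d.
Proof.
have E : (fun k : R => k^-1 *: (((fun t => f (x + t *: h)) \o shift s) (k *: 1)
            - f (x + s *: h)))
       = (fun k => k^-1 *: ((f \o shift (x + s *: h)) (k *: h)
            - f (x + s *: h))).
  apply/funext => k /=; congr (_ *: (f _ - _)).
  by rewrite [k *: 1]mulr1 scalerDl addrA addrAC addrC addrA.
by case=> fh <-; split; rewrite /derivable /derive E.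
Qed.

Lemma MVT_is_derive {R : realType} (f df : R -> R) (a b : R) : a < b ->
  (forall t, a <= t <= b -> is_derive t 1 f (df t)) ->
  exists2 c, a < c < b & f b - f a = df c * (b - a).
Proof.
move=> ab fdf; have [||c] := @MVT R f df a b ab.
- by move=> t; rewrite in_itv/= => /andP[? ?]; apply: fdf; rewrite !ltW.
- apply: derivable_within_continuous => t; rewrite in_itv/= => tab.
  by have [] := fdf t tab.
- by rewrite in_itv/=; exists c.
Qed.

Lemma ler_is_derive {R : realType} (f df : R -> R) (a b m : R) : a <= b ->
  (forall t, a <= t <= b -> is_derive t 1 f (df t)) ->
  (forall t, a <= t <= b -> m <= df t) -> m * (b - a) <= f b - f a.
Proof.
rewrite le_eqVlt => /predU1P[->|ab]; first by rewrite !subrr mulr0.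
move=> fdf dfm; have [c /andP[ac cb] ->] := MVT_is_derive ab fdf.
by rewrite ler_wpM2r ?subr_ge0 ?(ltW ab)// dfm// !ltW.
Qed.

Lemma ger_is_derive {R : realType} (f df : R -> R) (a b m : R) : a <= b ->
  (forall t, a <= t <= b -> is_derive t 1 f (df t)) ->
  (forall t, a <= t <= b -> df t <= m) -> f b - f a <= m * (b - a).
Proof.
rewrite le_eqVlt => /predU1P[->|ab]; first by rewrite !subrr mulr0.
move=> fdf dfm; have [c /andP[ac cb] ->] := MVT_is_derive ab fdf.
by rewrite ler_wpM2r ?subr_ge0 ?(ltW ab)// dfm// !ltW.
Qed.

(* [(f2 + e) ^ (-1/2)] is 1-Lipschitz; the shift by [e] avoids zeros of [f2]. *)
Lemma self_concordant_bounded {R : realType} (f f1 f2 f3 : R -> R) (b : R) :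
  0 < b ->
  (forall t, 0 <= t < b -> is_derive t 1 f (f1 t)) ->
  (forall t, 0 <= t < b -> is_derive t 1 f1 (f2 t)) ->
  (forall t, 0 <= t < b -> is_derive t 1 f2 (f3 t)) ->
  (forall t, 0 <= t < b -> 0 <= f2 t) ->
  (forall t, 0 <= t < b -> `|f3 t| <= 2 * (f2 t * Num.sqrt (f2 t))) ->
  b ^+ 2 * f2 0 < 1 ->
  exists C, forall t, 0 <= t < b -> f t <= C.
Proof.
move=> b0 df df1 df2 f2_ge0 f3_le bf2.
(* This [e] makes [b ^+ 2 * (f2 0 + e)] the midpoint of [b ^+ 2 * f2 0] and 1, hence still below 1;
   that is what [bw] needs. *)
pose e := (1 - b ^+ 2 * f2 0) / (2 * b ^+ 2).
have b20 : 0 < b ^+ 2 by rewrite exprn_gt0.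
have e0 : 0 < e by rewrite divr_gt0 ?mulr_gt0// subr_gt0.
have f2e_gt0 t : 0 <= t < b -> 0 < f2 t + e.
  by move=> tb; rewrite ltr_wpDl// f2_ge0.
pose w t := (Num.sqrt (f2 t + e))^-1.
have t0b : 0 <= (0 : R) < b by rewrite lexx.
have bw : b < w 0.
  rewrite /w -[ltLHS]invrK ltf_pV2 ?posrE ?invr_gt0 ?sqrtr_gt0 ?f2e_gt0//.
  rewrite -(@ltr_pXn2r _ 2) ?nnegrE ?sqrtr_ge0 ?invr_ge0 ?(ltW b0)//.
  rewrite sqr_sqrtr ?(ltW (f2e_gt0 _ t0b))// exprVn.
  rewrite -(ltr_pM2l b20) divff ?gt_eqF// mulrDr.
  have -> : b ^+ 2 * e = (1 - b ^+ 2 * f2 0) / 2.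
    by rewrite /e; field; rewrite gt_eqF.
  lra.
(* [w] falls by less than [b] on [[0, b)], so it stays above [k] and [f2] is at most [k ^- 2]; two
   integrations then bound [f1] and [f]. *)
pose k := w 0 - b; have k0 : 0 < k by rewrite subr_gt0.
have f2_le t : 0 <= t < b -> f2 t <= k ^- 2.
  move=> /andP[t0 tb].
  have sub s : 0 <= s <= t -> 0 <= s < b.
    by move=> /andP[-> st] /=; apply: le_lt_trans tb.
  have dw s : 0 <= s <= t -> is_derive s 1 w
      (- (Num.sqrt (f2 s + e)) ^- 2 * ((2 * Num.sqrt (f2 s + e))^-1 * f3 s)).
    move=> /sub st; apply: is_deriveV.
      by rewrite gt_eqF// sqrtr_gt0 f2e_gt0.
    apply: (@is_derive1_comp _ Num.sqrt (fun s => f2 s + e)).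
      exact/is_derive1_sqrt/f2e_gt0.
    rewrite -[f3 s]addr0; apply: is_deriveD; exact: df2.
  have dw_ge s : 0 <= s <= t ->
      -1 <= - (Num.sqrt (f2 s + e)) ^- 2 * ((2 * Num.sqrt (f2 s + e))^-1 * f3 s).
    move=> /sub st; rewrite mulNr lerN2.
    set q := Num.sqrt (f2 s + e).
    have q0 : 0 < q by rewrite sqrtr_gt0 f2e_gt0.
    rewrite mulrA -invfM mulrC ler_pdivrMr ?mul1r ?mulr_gt0 ?exprn_gt0//.
    apply: le_trans (ler_norm _) _; apply: le_trans (f3_le _ st) _.
    rewrite [leRHS]mulrCA ler_pM2l// sqr_sqrtr ?(ltW (f2e_gt0 _ st))//.
    rewrite ler_pM ?sqrtr_ge0 ?f2_ge0 ?lerDl ?(ltW e0)//.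
    by rewrite ler_wsqrtr// lerDl ltW.
  have kw : k <= w t.
    by have := ler_is_derive t0 dw dw_ge; rewrite /k; lra.
  have st : 0 <= t < b by rewrite t0.
  have : f2 t + e <= k ^- 2.
    rewrite -[f2 t + e]sqr_sqrtr ?(ltW (f2e_gt0 _ st))// -exprVn.
    rewrite ler_pXn2r ?nnegrE ?sqrtr_ge0 ?invr_ge0 ?(ltW k0)//.
    rewrite -[leLHS]invrK lef_pV2// posrE ?invr_gt0 ?sqrtr_gt0 ?f2e_gt0//.
  by apply: le_trans; rewrite lerDl ltW.
have kV0 : 0 <= k ^- 2 by rewrite invr_ge0 exprn_ge0// ltW.
have f1_le t : 0 <= t < b -> f1 t <= `|f1 0| + k ^- 2 * b.
  move=> /andP[t0 tb].
  have sub s : 0 <= s <= t -> 0 <= s < b.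
    by move=> /andP[-> st] /=; apply: le_lt_trans tb.
  have := @ger_is_derive _ f1 f2 0 t (k ^- 2) t0 (fun s st => df1 s (sub s st))
    (fun s st => f2_le s (sub s st)).
  rewrite subr0 lerBlDl => /le_trans; apply.
  by rewrite lerD ?ler_norm// ler_wpM2l// ltW.
exists (f 0 + (`|f1 0| + k ^- 2 * b) * b) => t /andP[t0 tb].
have sub s : 0 <= s <= t -> 0 <= s < b.
  by move=> /andP[-> st] /=; apply: le_lt_trans tb.
have := @ger_is_derive _ f f1 0 t _ t0 (fun s st => df s (sub s st))
  (fun s st => f1_le s (sub s st)).
rewrite subr0 lerBlDl => /le_trans; apply.
by rewrite lerD2l ler_wpM2l ?(ltW tb)// addr_ge0// mulr_ge0// ltW.
Qed.

(** If [f1 s > 0], then [- 1 / f1] grows at rate [f2 / f1 ^+ 2 >= 1 / nu] but has to stay negative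
    up to [L], which limits [L - s]. *)
Lemma slope_blowup {R : realType} (f1 f2 : R -> R) (nu s L : R) :
  0 < nu -> s < L ->
  (forall t, s <= t <= L -> is_derive t 1 f1 (f2 t)) ->
  (forall t, s <= t <= L -> f1 t ^+ 2 <= nu * f2 t) ->
  f1 s * (L - s) <= nu.
Proof.
move=> nu0 sL df1 f1_le; have Ls : 0 <= L - s by rewrite subr_ge0 ltW.
have [f1s|f1s] := leP (f1 s) 0.
  by apply: le_trans (ltW nu0); rewrite mulr_le0_ge0.
have f2_ge0 t : s <= t <= L -> 0 <= f2 t.
  by move=> /f1_le f1t; rewrite -(pmulr_rge0 _ nu0) (le_trans _ f1t)// sqr_ge0.
have f1_gt0 t : s <= t <= L -> 0 < f1 t.
  move=> /andP[st tL]; apply: lt_le_trans f1s _.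
  have sub u : s <= u <= t -> s <= u <= L.
    by move=> /andP[-> ut]; apply: le_trans tL.
  have := @ler_is_derive _ f1 f2 s t 0 st (fun u ut => df1 u (sub u ut))
    (fun u ut => f2_ge0 u (sub u ut)).
  by rewrite mul0r subr_ge0.
have dV t : s <= t <= L ->
    is_derive t 1 (fun t => - (f1 t)^-1) (- (- (f1 t) ^- 2 * f2 t)).
  move=> st; apply: is_deriveN; apply: is_deriveV; last exact: df1.
  by rewrite gt_eqF// f1_gt0.
have dV_ge t : s <= t <= L -> nu^-1 <= - (- (f1 t) ^- 2 * f2 t).
  move=> st; rewrite mulNr opprK mulrC ler_pdivlMr ?exprn_gt0 ?f1_gt0//.
  by rewrite ler_pdivrMl// f1_le.
have sLL : s <= L <= L by rewrite lexx ltW.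
have : 0 < (f1 L)^-1 by rewrite invr_gt0 f1_gt0.
move=> f1L; have le1 : nu^-1 * (L - s) <= (f1 s)^-1.
  by have := ler_is_derive (ltW sL) dV dV_ge; lra.
by move: le1; rewrite ler_pdivrMl// ler_pdivlMr// mulrC.
Qed.

(** Since [(beta + t) ^- 2] is the derivative of [- (beta + t)^-1], the function
    [f1 t + (beta + t)^-1] is nondecreasing. *)
Lemma slope_growth {R : realType} (f1 f2 : R -> R) (beta s : R) :
  0 < beta -> 0 <= s ->
  (forall t, 0 <= t <= s -> is_derive t 1 f1 (f2 t)) ->
  (forall t, 0 <= t <= s -> 1 <= (beta + t) ^+ 2 * f2 t) ->
  beta^-1 - (beta + s)^-1 <= f1 s - f1 0.
Proof.
move=> beta0 s0 df1 f2_ge.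
have bt t : 0 <= t <= s -> 0 < beta + t by move=> /andP[t0 _]; lra.
have dg t : 0 <= t <= s -> is_derive t 1 (fun t => f1 t + (beta + t)^-1)
    (f2 t + - (beta + t) ^- 2 * (0 + 1)).
  move=> ts; apply: is_deriveD; first exact: df1.
  by apply: is_deriveV; rewrite gt_eqF// bt.
have dg_ge t : 0 <= t <= s -> 0 <= f2 t + - (beta + t) ^- 2 * (0 + 1).
  move=> ts; rewrite add0r mulr1 subr_ge0.
  by rewrite -[leLHS]mulr1 mulrC ler_pdivrMr ?exprn_gt0 ?bt// mulrC f2_ge.
by have := ler_is_derive s0 dg dg_ge; rewrite addr0; lra.
Qed.

(** Up to a switching time, [slope_growth] bounds [f1 0] in terms of a later slope; from there to
    [1 + beta], [slope_blowup] bounds that later slope. *)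
Lemma slope_le {R : realType} (f1 f2 : R -> R) (nu beta : R) :
  1 <= nu -> 0 < beta -> 2 * beta * (nu + 2 * Num.sqrt nu) <= 1 ->
  (forall t, 0 <= t <= 1 + beta -> is_derive t 1 f1 (f2 t)) ->
  (forall t, 0 <= t <= 1 + beta -> f1 t ^+ 2 <= nu * f2 t) ->
  (forall t, 0 <= t <= 1 + beta -> 1 <= (beta + t) ^+ 2 * f2 t) ->
  f1 0 <= - (2 * beta)^-1.
Proof.
move=> nu1 beta0 betanu df1 f1_le f2_ge.
have nu0 : 0 < nu by lra.
set q := Num.sqrt nu in betanu *.
have q1 : 1 <= q by rewrite /q -[leLHS]sqrtr1 ler_wsqrtr.
have qq : q ^+ 2 = nu by rewrite sqr_sqrtr// ltW.
(* [p] minimizes the bound [nu / (1 + 2 * beta - p) + 1 / p] on [f1 0 + 1 / beta]. *)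
pose p := (1 + 2 * beta) / (1 + q).
have pq : p * (1 + q) = 1 + 2 * beta by rewrite divfK// gt_eqF//; lra.
have bp : beta <= p by rewrite /p ler_pdivlMr; nra.
have p0 : 0 < p by lra.
have pL : p - beta < 1 + beta by nra.
have s0 : 0 <= p - beta by rewrite subr_ge0.
(* By [pq], the interval left after the switching time [p - beta] has length
   [1 + 2 * beta - p = q * p]. *)
have H1 : f1 (p - beta) * (q * p) <= nu.
  have -> : q * p = (1 + beta) - (p - beta) by rewrite -[1]addr0; nra.
  apply: (@slope_blowup _ f1 f2) => // t /andP[t0 t1].
    by apply: df1; rewrite t1 (le_trans s0).
  by apply: f1_le; rewrite t1 (le_trans s0).
have sub t : 0 <= t <= p - beta -> 0 <= t <= 1 + beta.
  by move=> /andP[-> ts]/=; rewrite (le_trans ts)// ltW.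
have := @slope_growth _ f1 f2 beta (p - beta) beta0 s0
  (fun t ts => df1 t (sub t ts)) (fun t ts => f2_ge t (sub t ts)).
rewrite subrKC => H2.
have H3 : f1 (p - beta) <= q / p.
  by rewrite ler_pdivlMr//; nra.
(* With [p] expanded this reads [2 * beta * (1 + q) ^+ 2 <= 1 + 2 * beta], which is [betanu] because
   [q ^+ 2 = nu]. *)
have H4 : (1 + q) / p <= (2 * beta)^-1.
  rewrite ler_pdivrMr// ler_pdivlMl; last lra.
  nra.
have -> : - (2 * beta)^-1 = (2 * beta)^-1 - beta^-1.
  by field; rewrite gt_eqF.
rewrite mulrDl div1r in H4; lra.
Qed.

(** * Symmetry and sign of second derivatives; derivatives of matrix entries *)

Section second_derivatives.
Context {R : realType} {V : normedModType R}.
Implicit Types (f p q : V -> R) (x u v : V).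

Lemma differentiable_estimate f x e : differentiable f x -> 0 < e ->
  \forall k \near 0, `|f (x + k) - f x - 'd f x k| <= e * `|k|.
Proof.
move=> /diff_locally/eqaddoP df e0; apply: filterS (df _ e0) => k.
by rewrite !fctE/= opprD addrA [k + x]addrC.
Qed.

(** The mean value theorem in the direction [u] turns the second difference into [t] times a
    difference of two values of [p]; the first-order expansion of [p] at [x] evaluates both. *)
Lemma second_difference f p x u v e :
  (\forall y \near x, is_derive y u f (p y)) -> differentiable p x -> 0 < e ->
  \forall t \near 0^'+,
    `|f (x + t *: v + t *: u) - f (x + t *: v) - (f (x + t *: u) - f x)
      - t ^+ 2 * 'D_v p x| <= e * t ^+ 2.
Proof.
move=> /nbhs_ballP[d1 /= d10 fp] dp e0.
(* [t * m] dominates the sum of the lengths of the two increments [t *: v + c *: u] and [c *: u];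
   the [+ 1] keeps [m] positive. *)
pose m := 2 * `|u| + `|v| + 1.
have m0 : 0 < m by rewrite ltr_wpDl// addr_ge0// mulr_ge0.
have em0 : 0 < e / m by rewrite divr_gt0.
have /nbhs_ballP[d2 /= d20 pE] := differentiable_estimate dp em0.
pose d := Num.min d1 d2.
have d0 : 0 < d by rewrite lt_min d10.
near=> t.
have t0 : 0 < t by near: t; exact: nbhs_right_gt.
have tm : t * m < d.
  by rewrite -ltr_pdivlMr//; near: t; apply: nbhs_right_lt; rewrite divr_gt0.
have tu_tv s : 0 <= s <= t ->
    (`|s *: u| <= t * `|u|) * (`|t *: v + s *: u| <= t * (`|u| + `|v|)).
  move=> /andP[s0 st].
  have su : `|s *: u| <= t * `|u| by rewrite normrZ ger0_norm// ler_wpM2r.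
  split=> //; apply: le_trans (ler_normD _ _) _.
  by rewrite addrC mulrDr lerD// normrZ gtr0_norm.
have small s : 0 <= s <= t -> (`|s *: u| < d) * (`|t *: v + s *: u| < d).
  move=> /tu_tv[su tvsu]; have u0 : 0 <= `|u| by []; have v0 : 0 <= `|v| by [].
  split; first by apply: le_lt_trans su (le_lt_trans _ tm); rewrite /m; nra.
  by apply: le_lt_trans tvsu (le_lt_trans _ tm); rewrite /m; nra.
have psi s : 0 <= s <= t ->
    is_derive s 1 (fun s => f (x + t *: v + s *: u) - f (x + s *: u))
      (p (x + t *: v + s *: u) - p (x + s *: u)).
  move=> /small[su tvsu]; apply: is_deriveB; apply: is_derive_line; apply: fp.
    rewrite -ball_normE/= -addrA opprD addNKr normrN.
    by apply: lt_le_trans tvsu _; rewrite ge_min lexx.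
  rewrite -ball_normE/= opprD addNKr normrN.
  by apply: lt_le_trans su _; rewrite ge_min lexx.
have [c /andP[c0 ct]] := MVT_is_derive t0 psi.
rewrite !scale0r !addr0 subr0 opprB addrA => E.
have ctt : 0 <= c <= t by rewrite !ltW.
have := pE (c *: u); have := pE (t *: v + c *: u).
rewrite -!ball_normE/= !sub0r !normrN.
have [cu cuv] := small _ ctt; have [cu' cuv'] := tu_tv _ ctt.
move=> /(_ (lt_le_trans cuv _))/= + /(_ (lt_le_trans cu _)).
rewrite !ge_min !lexx !orbT => /(_ isT) A /(_ isT) B.
have -> : f (x + t *: v + t *: u) - f (x + t *: v) - (f (x + t *: u) - f x)
    = (p (x + t *: v + c *: u) - p (x + c *: u)) * t.
  by rewrite -E; ring.
rewrite deriveE//.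
move: A; rewrite linearD !linearZ/= addrA => A; move: B; rewrite linearZ/= => B.
set a := (X in `|X| <= _) in A; set b := (X in `|X| <= _) in B.
rewrite [X in `|X|](_ : _ = t * (a - b)); last first.
  by rewrite /a /b /GRing.scale/=; ring.
rewrite normrM gtr0_norm// expr2 mulrCA ler_pM2l//.
apply: le_trans (ler_normB _ _) _; apply: le_trans (lerD A B) _.
rewrite -mulrDr mulrAC ler_pdivrMr// -mulrA ler_pM2l//.
apply: le_trans (lerD cuv' cu') _; rewrite -mulrDr ler_pM2l// /m; lra.
Unshelve. all: by end_near. Qed.

(** The second difference is symmetric in [u] and [v], so after division by [t ^+ 2] it is close to
    both derivatives. *)
Lemma derive_comm f p q x u v :
  (\forall y \near x, is_derive y u f (p y)) ->
  (\forall y \near x, is_derive y v f (q y)) ->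
  differentiable p x -> differentiable q x -> 'D_v p x = 'D_u q x.
Proof.
move=> fp fq dp dq; apply/eqP; rewrite -subr_eq0 -normr_eq0.
apply: contraT; rewrite -normr_gt0 normr_id => A0.
(* With a quarter of the gap as tolerance, the two errors add up to only half of the gap. *)
have e0 : 0 < `|'D_v p x - 'D_u q x| / 4 by rewrite divr_gt0.
have H1 := second_difference v fp dp e0.
have H2 := second_difference u fq dq e0.
have [t [[{}H1 {}H2] t0]] := filter_ex (filterI (filterI H1 H2) (nbhs_right_gt (0 : R))).
move: H1 H2; rewrite [x + t *: u + t *: v]addrAC.
set D := `| _ - _| in e0 A0 *; set F := f (x + _ + _) => H1 H2.
have t20 : 0 < t ^+ 2 by rewrite exprn_gt0.
suff : t ^+ 2 * D <= D / 4 * t ^+ 2 + D / 4 * t ^+ 2 by nra.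
have -> : t ^+ 2 * D = `|t ^+ 2 * ('D_v p x - 'D_u q x)|.
  by rewrite normrM (ger0_norm (ltW t20)).
apply: le_trans (lerD H1 H2); rewrite [leRHS]addrC.
apply: le_trans (ler_normB _ _).
by rewrite le_eqVlt; apply/orP; left; apply/eqP; congr `|_|; ring.
Qed.

(** By the mean value theorem [g t + g (- t) - 2 * g 0] is [t * (g1 c - g1 (- c))], and the last
    factor is about [2 * c * d]. *)
Lemma is_derive2_ge0 (g g1 : R -> R) (d e : R) : 0 < e ->
  (forall s : R, `|s| < e -> is_derive s (1 : R) g (g1 s)) ->
  is_derive (0 : R) (1 : R) g1 d ->
  (forall s : R, `|s| < e -> 2 * g 0 <= g s + g (- s)) -> 0 <= d.
Proof.
move=> e0 dg dg1 cvx; rewrite leNgt; apply/negP => d0.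
have [/derivable_nbhs dg1' g1d] := dg1; rewrite g1d in dg1'.
(* The tolerance [- d / 2] leaves [g1 c - g1 (- c) <= c * d < 0]. *)
have d20 : 0 < - d / 2 by rewrite divr_gt0// oppr_gt0.
have /eqaddoP/(_ _ d20)/nbhs_ballP[r /= r0 H] := dg1'.
have {}H s : `|s| < r -> `|g1 s - g1 0 - s * d| <= - d / 2 * `|s|.
  move=> sr; have := H s; rewrite -ball_normE/= sub0r normrN => /(_ sr).
  by rewrite !fctE/= opprD addrA [s *: 1]mulr1 addr0.
pose k := Num.min e r; have k0 : 0 < k by rewrite lt_min e0.
pose t := k / 2; have t0 : 0 < t by rewrite divr_gt0.
have tk : t < k by rewrite /t; lra.
have te : t < e by apply: lt_le_trans tk _; rewrite ge_min lexx.
have tr : t < r by apply: lt_le_trans tk _; rewrite ge_min lexx orbT.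
have dG s : 0 <= s <= t ->
    is_derive s 1 (fun s => g s + g (- s)) (g1 s - g1 (- s)).
  move=> /andP[s0 st]; apply: is_deriveD.
    by apply: dg; rewrite ger0_norm// (le_lt_trans st).
  rewrite -mulrN1; apply: is_derive1_comp.
  by apply: dg; rewrite normrN ger0_norm// (le_lt_trans st).
have [c /andP[c0 ct]] := MVT_is_derive t0 dG.
rewrite oppr0 addr0 => E.
have cr : c < r by apply: lt_trans tr.
have := H c; have := H (- c); rewrite normrN gtr0_norm//.
move=> /(_ cr)/ler_normlP[A1 A2] /(_ cr)/ler_normlP[B1 B2].
have := cvx t; rewrite gtr0_norm// => /(_ te) C.
have : 0 <= (g1 c - g1 (- c)) * t by rewrite -E; lra.
rewrite pmulr_lge0// => C'.
nra.
Qed.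

Lemma differentiable_mulmx_entry m n (M : V -> 'M[R]_(m, n)) x
    (a : 'rV[R]_m) (b : 'cV[R]_n) : differentiable M x ->
  differentiable (fun y => (a *m M y *m b) 0 0) x.
Proof.
move=> dM.
have -> : (fun y => (a *m M y *m b) 0 0) =
    \sum_(j < n) (\sum_(i < m) (a 0 i *: ((fun A : 'M[R]_(m, n) => A i j) \o M))) * cst (b j 0).
  apply/funext => y; rewrite fct_sumE !mxE; apply: eq_bigr => j _.
  by rewrite fctE fct_sumE !mxE; congr (_ * _).
apply: differentiable_sum => j; apply: differentiableM; last exact: differentiable_cst.
apply: differentiable_sum => i; apply: differentiableZ.
by apply: differentiable_comp => //; exact: differentiable_coord.
Qed.

Lemma derive_mulmx_entry m n (M : V -> 'M[R]_(m, n)) x v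
    (a : 'rV[R]_m) (b : 'cV[R]_n) : differentiable M x ->
  'D_v (fun y => (a *m M y *m b) 0 0) x = (a *m 'D_v M x *m b) 0 0.
Proof.
move=> dM; have dMv : derivable M x v by exact: diff_derivable.
rewrite derive_mx//.
have dMij i j : derivable (fun y => M y i j) x v.
  exact: (derivable_mxP _ _ _).1.
have -> : (fun y => (a *m M y *m b) 0 0) =
    \sum_(j < n) (\sum_(i < m) (a 0 i *: (fun y => M y i j))) * cst (b j 0).
  apply/funext => y; rewrite fct_sumE !mxE; apply: eq_bigr => j _.
  by rewrite fctE fct_sumE !mxE; congr (_ * _).
have dS j : derivable (\sum_(i < m) (a 0 i *: (fun y => M y i j))) x v.
  by apply: derivable_sum => i; exact: derivableZ.
rewrite derive_sum; last by move=> j; apply: derivableM.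
rewrite !mxE; apply: eq_bigr => j _.
rewrite deriveM// derive_cst scaler0 add0r derive_sum; last first.
  by move=> i; exact: derivableZ.
rewrite mulrC mxE; congr (_ * _); apply: eq_bigr => i _.
by rewrite deriveZ// mxE.
Qed.

End second_derivatives.

(** * Directional derivatives through the gradient and the Hessian *)

Section gradient_hessian.
Context {R : realType} {n : nat}.
Implicit Types (f : 'rV[R]_n -> R) (x u v : 'rV[R]_n).

Lemma derive_gradient f x u : differentiable f x ->
  'D_u f x = (gradient f x *m u^T) 0 0.
Proof.
move=> df; rewrite deriveE// [in LHS](row_sum_delta u) linear_sum mxE.
by apply: eq_bigr => i _; rewrite linearZ/= !mxE deriveE// mulrC.
Qed.

(** The factor [1%:M] gives the shape [a *m M y *m b] that the lemmas on matrix entries expect. *)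
Lemma gradient_entry f u :
  (fun y => (gradient f y *m u^T) 0 0) =
  (fun y => (1%:M *m gradient f y *m u^T) 0 0).
Proof. by apply/funext => y; rewrite mul1mx. Qed.

Lemma is_derive_gradient f x u : (\forall y \near x, differentiable f y) ->
  \forall y \near x, is_derive y u f ((gradient f y *m u^T) 0 0).
Proof.
apply: filterS => y dfy; rewrite -derive_gradient//.
exact/derivableP/diff_derivable.
Qed.

Lemma derive_gradient_entry f x u v : differentiable (gradient f) x ->
  'D_v (fun y => (gradient f y *m u^T) 0 0) x = (v *m hessian f x *m u^T) 0 0.
Proof.
by move=> dg; rewrite gradient_entry derive_mulmx_entry// mul1mx deriveEjacobian.
Qed.

Lemma hessian_sym f x u v : (\forall y \near x, differentiable f y) ->
  differentiable (gradient f) x ->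
  (v *m hessian f x *m u^T) 0 0 = (u *m hessian f x *m v^T) 0 0.
Proof.
move=> df dg; rewrite -!derive_gradient_entry//.
apply: (@derive_comm _ _ f); try exact: is_derive_gradient;
  rewrite gradient_entry; exact: differentiable_mulmx_entry.
Qed.

Lemma is_derive_derive f x u v : (\forall y \near x, differentiable f y) ->
  differentiable (gradient f) x ->
  is_derive x v ('D_u f) ((v *m hessian f x *m u^T) 0 0).
Proof.
move=> df dg; apply: (near_eq_is_derive (f := fun y => (gradient f y *m u^T) 0 0)).
  by apply: filterS df => y dfy; rewrite derive_gradient.
rewrite -derive_gradient_entry//; apply/derivableP/diff_derivable.
by rewrite gradient_entry; exact: differentiable_mulmx_entry.
Qed.

End gradient_hessian.

(** * Convex sets, and lines leaving an open set *)

Section convexity.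
Context {R : realType} {n : nat}.
Implicit Types (K : set 'rV[R]_n) (a b x h : 'rV[R]_n).

Lemma convex_set_segment K a b (s : R) : convex_set K -> K a -> K b -> 0 <= s <= 1 ->
  K (a + s *: (b - a)).
Proof.
move=> cK Ka Kb /andP[s0 s1].
have := cK b a (Itv01 s0 s1) (mem_set Kb) (mem_set Ka) => /set_mem.
rewrite /conv/=; congr K.
by rewrite /unstable.onem scalerBl scale1r scalerBr addrC -addrA [- _ + _]addrC.
Qed.

(** The homothety of centre [b] and ratio [1 - s] carries a neighbourhood of [a] inside [K] to one
    of the target point; [g] is its inverse. *)
Lemma convex_set_interior K a b (s : R) : convex_set K -> K° a -> K b ->
  0 <= s < 1 -> K° (a + s *: (b - a)).
Proof.
move=> cK Ka Kb /andP[s0 s1]; have s10 : 1 - s != 0 by rewrite gt_eqF ?subr_gt0.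
rewrite /interior/=.
pose g y : 'rV[R]_n := (1 - s)^-1 *: (y - s *: b).
have gc : {for a + s *: (b - a), continuous g}.
  apply: continuous_comp; last exact: scaler_continuous.
  by apply: (@continuousB _ _ _ id (cst (s *: b))); [exact: cvg_id|exact: cst_continuous].
have ga : g (a + s *: (b - a)) = a.
  by apply/rowP => i; rewrite !mxE; field.
have : \forall y \near a + s *: (b - a), K (g y).
  by apply: gc; rewrite ga.
apply: filterS => y Kgy.
have := convex_set_segment cK Kgy Kb (s := s); rewrite s0 ltW// => /(_ isT).
by congr K; apply/rowP => i; rewrite !mxE; field.
Qed.

Lemma open_line (U : set 'rV[R]_n) x h (t : R) : open U -> U (x + t *: h) ->
  exists2 e : R, 0 < e & forall s, `|s - t| < e -> U (x + s *: h).
Proof.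
move=> oU Ux; have lc : {for t, continuous (fun s : R => x + s *: h)}.
  by apply: continuousD; [exact: cvg_cst|exact: scalel_continuous].
have /nbhs_ballP[e /= e0 H] : \forall s \near t, U (x + s *: h).
  by apply: lc; exact: open_nbhs_nbhs.
by exists e => // s st; apply: H; rewrite -ball_normE/= distrC.
Qed.

Lemma exit_time (U : set 'rV[R]_n) x h (beta : R) : open U -> U x -> 0 < beta ->
  ~ U (x + beta *: h) ->
  exists b : R, [/\ 0 < b <= beta, ~ U (x + b *: h) &
                forall t, 0 <= t < b -> U (x + t *: h)].
Proof.
move=> oU Ux beta0 nU.
(* Asking for the whole initial segment makes [S] an interval, so its supremum is the first exit
   time. *)
pose S := [set t : R | 0 <= t /\ forall s, 0 <= s <= t -> U (x + s *: h)].
have Sbeta t : S t -> t <= beta.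
  move=> [t0 tU]; rewrite leNgt; apply/negP => bt; apply: nU.
  by apply: tU; rewrite !ltW.
have Ux0 : U (x + 0 *: h) by rewrite scale0r addr0.
have S0 : S 0.
  split=> // s s0; have -> : s = 0 by apply/eqP; rewrite eq_le andbC.
  exact: Ux0.
have hS : has_sup S by split; [exists 0|exists beta].
have before t : 0 <= t < sup S -> U (x + t *: h).
  move=> /andP[t0 tS]; have := sup_adherent (eps := sup S - t) _ hS.
  rewrite subr_gt0 => /(_ tS)[t' [_ St']]; rewrite subKr => tt'.
  by apply: St'; rewrite t0 ltW.
(* Used at [b = 0] to make the supremum positive, and at [b = sup S] to show that the line has left
   [U] there. *)
have ext (b e : R) : 0 <= b -> 0 < e -> (forall t, 0 <= t < b -> U (x + t *: h)) ->
    (forall s, `|s - b| < e -> U (x + s *: h)) -> b + e / 2 <= sup S.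
  move=> b0 e0 Hb He; apply: ub_le_sup; first exact: hS.2.
  have e20 : 0 < e / 2 by rewrite divr_gt0.
  split; first by lra.
  move=> s /andP[s0 sb]; have [sb'|sb'] := ltP s b; first by apply: Hb; rewrite s0.
  apply: He; rewrite ger0_norm ?subr_ge0//; lra.
exists (sup S); split => //.
- rewrite ge_sup//; last by exists 0.
  rewrite andbT; have [e e0 He] := open_line oU Ux0.
  suff : 0 + e / 2 <= sup S by apply: lt_le_trans; rewrite add0r divr_gt0.
  by apply: ext => // t /andP[t0 t1]; have := lt_le_trans t1 t0; rewrite ltxx.
- move=> UxS; have [e e0 He] := open_line oU UxS.
  have := ext _ _ (sup_upper_bound hS S0) e0 before He; lra.
Qed.

(** As [harmonic i] is [1 / (i + 1)], the parameters start at 0 and approach [b] without reaching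
    it: the exit point is a limit from inside, as closedness and [scb_boundary] require. *)
Lemma line_cvg x h (b : R) :
  (fun i => x + (b - b * harmonic i) *: h) @ \oo --> x + b *: h.
Proof.
have bc : (fun i => b - b * harmonic i) @ \oo --> b.
  rewrite -[X in _ --> X]subr0 -[X in _ - X](mulr0 b).
  apply: cvgB; first exact: cvg_cst.
  by apply: cvgM; [exact: cvg_cst|exact: cvg_harmonic].
apply: cvgD; first exact: cvg_cst.
exact: (cvg_comp _ _ bc (@scalel_continuous _ _ h b)).
Qed.

Lemma harmonic_lt (b : R) i : 0 < b -> 0 <= b - b * harmonic i < b.
Proof.
move=> b0; have h0 : 0 < @harmonic R i by rewrite invr_gt0.
rewrite gtrBl mulr_gt0// andbT subr_ge0 ger_pMr//.
by rewrite invf_le1// ler1n.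
Qed.

End convexity.

(** * Estimates for a self-concordant barrier along a line *)

Section barrier.
Context {R : realType} {n : nat} {nu : R} {K : set 'rV[R]_n}.
Context {phi : 'rV[R]_n -> R} (scb : self_concordant_barrier nu K phi).
Implicit Types (x h : 'rV[R]_n).

Let near_interior x : K° x -> \forall y \near x, K° y.
Proof. by move=> Kx; apply: open_nbhs_nbhs; split => //; exact: open_interior. Qed.

Let near_diff x : K° x -> \forall y \near x, differentiable phi y.
Proof.
by move=> /near_interior; apply: filterS => y /(scb_differentiable scb)[].
Qed.

Lemma barrier_diff2E x h : K° x ->
  diff2 phi x h = (h *m hessian phi x *m h^T) 0 0.
Proof.
move=> Kx; have [_ dg _] := scb_differentiable scb Kx.
by rewrite /diff2; have [_ ->] := is_derive_derive h h (near_diff Kx) dg.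
Qed.

Lemma barrier_diff2N x h : K° x -> diff2 phi x (- h) = diff2 phi x h.
Proof.
by move=> Kx; rewrite !barrier_diff2E// linearN mulmxN !mulNmx opprK.
Qed.

Lemma barrier_is_derive1 x h : K° x -> is_derive x h phi ('D_h phi x).
Proof.
by move=> /(scb_differentiable scb)[d _ _]; apply/derivableP/diff_derivable.
Qed.

Lemma barrier_is_derive2 x h : K° x -> is_derive x h ('D_h phi) (diff2 phi x h).
Proof.
move=> Kx; have [_ dg _] := scb_differentiable scb Kx.
rewrite barrier_diff2E//; exact: (is_derive_derive h h (near_diff Kx) dg).
Qed.

Lemma barrier_is_derive3 x h : K° x ->
  is_derive x h (fun y => diff2 phi y h) (diff3 phi x h).
Proof.
move=> Kx; apply/derivableP.
apply: (near_eq_derivable (f := fun y => (h *m hessian phi y *m h^T) 0 0)).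
  by near do rewrite barrier_diff2E//; exact: near_interior.
apply: diff_derivable; apply: differentiable_mulmx_entry.
by have [] := scb_differentiable scb Kx.
Unshelve. all: by end_near. Qed.

(** Convexity of [phi] is used only at the midpoint [x] of [x + s *: h] and [x - s *: h]. *)
Lemma barrier_diff2_ge0 x h : K° x -> 0 <= diff2 phi x h.
Proof.
move=> Kx; have Kx0 : K° (x + 0 *: h) by rewrite scale0r addr0.
have [e e0 Ke] := open_line (open_interior K) Kx0.
have {}Ke s : `|s| < e -> K° (x + s *: h).
  by move=> se; apply: Ke; rewrite subr0.
apply: (@is_derive2_ge0 _ (fun s => phi (x + s *: h))
  (fun s => 'D_h phi (x + s *: h)) _ e e0).
- by move=> s se; apply: is_derive_line; apply: barrier_is_derive1; exact: Ke.
- rewrite -[x in diff2 phi x]addr0 -[X in x + X](scale0r h).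
  apply: (@is_derive_line _ _ ('D_h phi)); exact: barrier_is_derive2.
- move=> s se; have Ks := Ke _ se.
  have KNs : K° (x + (- s) *: h) by apply: Ke; rewrite normrN.
  have h0 : 0 <= (2^-1 : R) by []; have h1 : (2^-1 : R) <= 1 by lra.
  have onem2 : unstable.onem (2^-1 : R) = 2^-1 by rewrite /unstable.onem; lra.
  have mid : 2^-1 *: (x + s *: h) + unstable.onem 2^-1 *: (x + - s *: h) = x.
    rewrite onem2 -scalerDr scaleNr addrACA subrr addr0.
    have -> : x + x = 2 *: x by rewrite scaler_nat mulr2n.
    by rewrite scalerA mulVf// scale1r.
  have H : phi (2^-1 *: (x + s *: h) + unstable.onem 2^-1 *: (x + - s *: h))
      <= 2^-1 * phi (x + s *: h) + unstable.onem 2^-1 * phi (x + - s *: h).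
    exact: (scb_convex scb (Itv01 h0 h1) (mem_set Ks) (mem_set KNs)).
  rewrite mid onem2 in H; rewrite scale0r addr0; lra.
Qed.

(** Cauchy-Schwarz for the Hessian form [B], between [h] and the vector [w] that represents the
    gradient in [B]; the barrier parameter bounds [B w w]. *)
Lemma barrier_slope_diff2 x h : K° x ->
  ('D_h phi x) ^+ 2 <= nu * diff2 phi x h.
Proof.
move=> Kx; have [dphi dg _] := scb_differentiable scb Kx.
have nu1 := scb_nu_ge1 scb; have nu0 : 0 < nu by lra.
have [uH] := scb_parameter scb Kx.
set H := hessian phi x in uH *; set g := gradient phi x.
pose w := g *m invmx H; rewrite -/w => wg.
have wH : w *m H = g by rewrite /w mulmxKV.
pose B (u v : 'rV[R]_n) := (u *m H *m v^T) 0 0.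
have BC u v : B u v = B v u by rewrite /B hessian_sym//; exact: near_diff.
have Bw u : B w u = (g *m u^T) 0 0 by rewrite /B wH.
(* The minimizer of [B h h + 2 * t * B w h + t ^+ 2 * nu]; dividing by [nu] instead of [B w w]
   covers the case [w = 0]. *)
pose t := - B w h / nu.
have Bge0 : 0 <= B (h + t *: w) (h + t *: w).
  by have := barrier_diff2_ge0 (h + t *: w) Kx; rewrite barrier_diff2E.
have : B (h + t *: w) (h + t *: w) = B h h + 2 * t * B w h + t ^+ 2 * B w w.
  have -> : B (h + t *: w) (h + t *: w)
      = B h h + t * B h w + (t * B w h + t * (t * B w w)).
    rewrite /B linearD/= linearZ/= !mulmxDl !mulmxDr -!scalemxAl -!scalemxAr.
    by rewrite !mxE; ring.
  by rewrite (BC h w); ring.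
have Bww : B w w <= nu.
  apply: le_trans wg; rewrite Bw !mxE le_eqVlt; apply/orP; left; apply/eqP.
  by apply: eq_bigr => i _; rewrite !mxE mulrC.
rewrite barrier_diff2E// derive_gradient// -/g -Bw -/(B h h) => E.
rewrite E in Bge0.
have t2 : t ^+ 2 * B w w <= t ^+ 2 * nu by rewrite ler_wpM2l// sqr_ge0.
have tE : B w h = - t * nu by rewrite /t; field; rewrite gt_eqF.
rewrite tE in Bge0 *; nra.
Qed.

(** Otherwise [self_concordant_bounded] keeps [phi] bounded up to the exit time [b <= beta], while
    [phi] must tend to infinity at the exit point. *)
Lemma barrier_dikin x h beta : K° x -> 0 < beta -> ~ K° (x + beta *: h) ->
  1 <= beta ^+ 2 * diff2 phi x h.
Proof.
move=> Kx beta0 nK; rewrite leNgt; apply/negP => lt1.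
have [b [/andP[b0 bbeta] nKb Kb]] := exit_time (open_interior K) Kx beta0 nK.
have x0 : x + 0 *: h = x by rewrite scale0r addr0.
have [||C HC] := @self_concordant_bounded _ (fun t => phi (x + t *: h))
  (fun t => 'D_h phi (x + t *: h)) (fun t => diff2 phi (x + t *: h) h)
  (fun t => diff3 phi (x + t *: h) h) b b0
  (fun t tb => is_derive_line (barrier_is_derive1 h (Kb t tb)))
  (fun t tb => is_derive_line (barrier_is_derive2 h (Kb t tb)))
  (fun t tb => is_derive_line (barrier_is_derive3 h (Kb t tb)))
  (fun t tb => barrier_diff2_ge0 h (Kb t tb)).
- move=> t /Kb Kt; apply: le_trans (scb_self_concordant scb h Kt) _.
  have := barrier_diff2_ge0 h Kt; move: (diff2 _ _ _) => d d0.
  (* Splitting the exponent turns the power into [d * Num.sqrt d]. *)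
  have -> : (3 / 2 : R) = 1 + 2^-1 by lra.
  rewrite powRD; last by apply/implyP => /eqP; lra.
  by rewrite (powRr1 d0) (powR12_sqrt d0); exact: lexx.
- rewrite x0; apply: le_lt_trans lt1; rewrite ler_wpM2r ?barrier_diff2_ge0//.
  by rewrite ler_pXn2r ?nnegrE ?(ltW b0) ?(ltW beta0).
have cvgz := @line_cvg _ _ x h b.
have Ku i : K° (x + (b - b * harmonic i) *: h) by apply: Kb; exact: harmonic_lt.
have Kz : K (x + b *: h).
  apply: (closed_cvg _ (scb_closed scb)) cvgz.
  by apply: nearW => i; exact: interior_subset.
have := scb_boundary scb Ku _ cvgz.
move=> /(_ (conj (subset_closure Kz) nKb))/cvgryPgt/(_ C)[N _ /(_ N (leqnn N))/=].
by rewrite ltNge HC// harmonic_lt.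
Qed.

Lemma barrier_slope_le x h beta : K° x -> 0 < beta ->
  2 * beta * (nu + 2 * Num.sqrt nu) <= 1 -> ~ K° (x - beta *: h) ->
  (forall t, 0 <= t <= 1 + beta -> K° (x + t *: h)) ->
  'D_h phi x <= - (2 * beta)^-1.
Proof.
move=> Kx beta0 betanu nK Kt; have x0 : x + 0 *: h = x by rewrite scale0r addr0.
have := @slope_le _ (fun t => 'D_h phi (x + t *: h))
  (fun t => diff2 phi (x + t *: h) h) nu beta (scb_nu_ge1 scb) beta0 betanu
  (fun t tb => is_derive_line (barrier_is_derive2 h (Kt t tb)))
  (fun t tb => barrier_slope_diff2 h (Kt t tb)).
(* From [x + t *: h], a backward step of length [beta + t] along [- h] reaches the non-interior
   point [x - beta *: h], so the Dikin bound applies with [beta + t]. *)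
rewrite x0; apply => t tb; rewrite -barrier_diff2N; last exact: Kt.
apply: barrier_dikin; [exact: Kt| |].
  by case/andP: tb => t0 _; lra.
by rewrite scalerN scalerDl [beta *: h + _]addrC opprD addrA addrK.
Qed.

End barrier.

(** * The Euclidean norm and Cauchy-Schwarz *)

Section euclidean_norm.
Context {R : realType} {n : nat}.
Implicit Types (u v : 'rV[R]_n) (a : R).

Lemma enorm_ge0 u : 0 <= enorm u.
Proof. exact: sqrtr_ge0. Qed.

Lemma sqr_enorm u : enorm u ^+ 2 = (u *m u^T) 0 0.
Proof.
rewrite sqr_sqrtr ?sumr_ge0// => [|i _]; last exact: sqr_ge0.
by rewrite mxE; apply: eq_bigr => i _; rewrite mxE expr2.
Qed.

Lemma enormZ a u : enorm (a *: u) = `|a| * enorm u.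
Proof.
rewrite /enorm -sqrtr_sqr -sqrtrM ?sqr_ge0// mulr_sumr.
by congr Num.sqrt; apply: eq_bigr => i _; rewrite mxE exprMn.
Qed.

Lemma enormN u : enorm (- u) = enorm u.
Proof. by rewrite -scaleN1r enormZ normrN1 mul1r. Qed.

Lemma enorm_eq0 u : enorm u = 0 -> u = 0.
Proof.
move=> /eqP; rewrite sqrtr_eq0 => u0; apply/rowP => i; rewrite mxE.
have {}u0 : \sum_(i < n) u 0 i ^+ 2 = 0.
  by apply: le_anti; rewrite u0 sumr_ge0// => j _; exact: sqr_ge0.
have /eqP := u0; rewrite psumr_eq0; last by move=> j _; exact: sqr_ge0.
by move=> /allP/(_ i); rewrite mem_index_enum sqrf_eq0 => /(_ isT)/eqP.
Qed.

Lemma cauchy_schwarz u v : (u *m v^T) 0 0 <= enorm u * enorm v.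
Proof.
have [v0|v0] := eqVneq (enorm v) 0.
  by rewrite v0 (enorm_eq0 v0) trmx0 mulmx0 mxE mulr0.
have vgt : 0 < enorm v by rewrite lt_neqAle eq_sym v0 enorm_ge0.
set S := (u *m v^T) 0 0.
(* The component of [u] orthogonal to [v], scaled by [enorm v ^+ 2] to avoid a division. *)
pose w := enorm v ^+ 2 *: u - S *: v.
have : 0 <= (w *m w^T) 0 0 by rewrite -sqr_enorm sqr_ge0.
have -> : (w *m w^T) 0 0 =
    enorm v ^+ 2 * (enorm v ^+ 2 * enorm u ^+ 2 - S ^+ 2).
  have vuS : (v *m u^T) 0 0 = S.
    by rewrite /S !mxE; apply: eq_bigr => i _; rewrite !mxE mulrC.
  have -> : (w *m w^T) 0 0 = enorm v ^+ 2 * (enorm v ^+ 2 * (u *m u^T) 0 0)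
     - enorm v ^+ 2 * (S * (u *m v^T) 0 0)
     - S * (enorm v ^+ 2 * (v *m u^T) 0 0) + S * (S * (v *m v^T) 0 0).
    rewrite !mxE !mulr_sumr -!sumrB -big_split/=; apply: eq_bigr => i _.
    by rewrite !mxE; ring.
  by rewrite vuS -!sqr_enorm -/S; ring.
rewrite pmulr_rge0 ?exprn_gt0// subr_ge0 -exprMn => H.
rewrite mulrC; have [S0|S0] := leP S 0.
  by apply: le_trans S0 _; rewrite mulr_ge0 ?enorm_ge0.
by rewrite -(@ler_pXn2r _ 2) ?nnegrE ?(ltW S0) ?mulr_ge0 ?enorm_ge0.
Qed.

Lemma ler_enormD u v : enorm (u + v) <= enorm u + enorm v.
Proof.
rewrite -(@ler_pXn2r _ 2) ?nnegrE ?addr_ge0 ?enorm_ge0//.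
have -> : enorm (u + v) ^+ 2 =
    enorm u ^+ 2 + (u *m v^T) 0 0 + ((v *m u^T) 0 0 + enorm v ^+ 2).
  by rewrite !sqr_enorm linearD/= !mulmxDl !mulmxDr !mxE.
have := cauchy_schwarz u v; have := cauchy_schwarz v u; nra.
Qed.

End euclidean_norm.

(** * First-order optimality, the boundary point on the segment, and the final estimate *)

Lemma derive_argmin {R : realType} {n : nat} (U : set 'rV[R]_n)
    (F : 'rV[R]_n -> R) (x h : 'rV[R]_n) : open U ->
  (forall y, U y -> derivable F y h) -> is_argmin U F x -> 'D_h F x = 0.
Proof.
move=> oU dF [Ux Fx]; have x0 : x + 0 *: h = x by rewrite scale0r addr0.
have Ux0 : U (x + 0 *: h) by rewrite x0.
have [e e0 Ue] := open_line oU Ux0.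
have {}Ue s : s \in `](- e), e[ -> U (x + s *: h).
  by move=> se; apply: Ue; rewrite subr0 ltr_norml; move: se; rewrite in_itv.
have dline s : s \in `](- e), e[ ->
    is_derive s 1 (fun t => F (x + t *: h)) ('D_h F (x + s *: h)).
  by move=> /Ue/dF dFs; apply: is_derive_line; exact: derivableP.
have e00 : 0 \in `](- e), e[ by rewrite in_itv/= oppr_lt0 e0.
have [||||_] := @derive1_at_min _ (fun t => F (x + t *: h)) (- e) e 0.
- by lra.
- by move=> t /dline[].
- exact: e00.
- by move=> t /Ue Ut; rewrite x0; exact: Fx.
have [_ ->] := dline 0 e00.
by rewrite x0.
Qed.

(** The point sought is the exit point from the interior. It lies in [K] by closedness, hence
    differs from [p], which makes the inequality strict. *)
Lemma boundary_on_segment {R : realType} {n : nat} (K : set 'rV[R]_n)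
    (x p : 'rV[R]_n) : closed K -> K° x -> ~ K p ->
  exists2 z, K z /\ ~ K° z & enorm (z - x) < enorm (p - x).
Proof.
move=> cK Kx nKp.
have nKp1 : ~ K° (x + 1 *: (p - x)).
  by rewrite scale1r addrC subrK => /interior_subset.
have [b [/andP[b0 b1] nKb Kb]] := exit_time (open_interior K) Kx ltr01 nKp1.
have Kz : K (x + b *: (p - x)).
  apply: (closed_cvg _ cK) (@line_cvg _ _ x (p - x) b).
  by apply: nearW => i; apply: interior_subset; apply: Kb; exact: harmonic_lt.
exists (x + b *: (p - x)) => //.
have px0 : 0 < enorm (p - x).
  rewrite lt_neqAle enorm_ge0 andbT eq_sym; apply/eqP => /enorm_eq0/eqP.
  by rewrite subr_eq0 => /eqP px; apply: nKp; rewrite px; exact: interior_subset.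
rewrite addrC addKr enormZ gtr0_norm// gtr_pMl//.
rewrite lt_neqAle b1 andbT; apply/eqP => bE; apply: nKp.
by move: Kz; rewrite bE scale1r addrC subrK.
Qed.

(* With [h := xbar - z], the point [x + h = xbar + (x - z)] lies in the inner ball and
   [enorm h <= Rad]; the direction [xbar - x] would lose a constant factor. *)
Lemma slope_towards_center {R : realType} {n : nat} (K : set 'rV[R]_n)
    (phi : 'rV[R]_n -> R) (nu r Rad : R) (xbar x z : 'rV[R]_n) :
  self_concordant_barrier nu K phi -> 0 < r ->
  eball xbar r `<=` K -> K `<=` eball xbar Rad ->
  K° x -> K z -> ~ K° z ->
  enorm (z - x) * (Rad * (2 * nu + 4 * Num.sqrt nu)) <= r ^+ 2 ->
  'D_(xbar - z) phi x <= - (r / (2 * enorm (z - x))).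
Proof.
move=> scb r0 inner outer Kx Kz nKz small.
set delta := enorm (z - x) in small *; set h := xbar - z.
have hRad : enorm h <= Rad by exact: outer.
have delta0 : 0 < delta.
  rewrite lt_neqAle enorm_ge0 andbT eq_sym; apply/eqP => /enorm_eq0/eqP.
  by rewrite subr_eq0 => /eqP zx; apply: nKz; rewrite zx.
have nu1 := scb_nu_ge1 scb.
set q := Num.sqrt nu in small.
have q1 : 1 <= q by rewrite /q -[leLHS]sqrtr1 ler_wsqrtr.
pose beta := delta / r; have beta0 : 0 < beta by rewrite divr_gt0.
have deltaE : delta = beta * r by rewrite divfK// gt_eqF.
clearbody beta.
(* A point at distance exactly [r] from [xbar], hence in [K]; it yields [r <= Rad] and serves again
   to show that [x - beta *: h] is not interior. *)
pose y := xbar + beta^-1 *: (z - x).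
have Ky : eball xbar r y.
  rewrite /eball/closed_ball_/= /y opprD addNKr enormN enormZ gtr0_norm ?invr_gt0//.
  by rewrite -/delta deltaE mulKf// gt_eqF.
have rRad : r <= Rad.
  have := outer _ (inner _ Ky); rewrite /eball/closed_ball_/= /y.
  rewrite opprD addNKr enormN enormZ gtr0_norm ?invr_gt0//.
  by rewrite -/delta deltaE mulKf// gt_eqF.
have betaRad : beta * Rad * (2 * nu + 4 * q) <= r.
  rewrite -(ler_pM2l r0) -expr2; apply: le_trans small.
  by rewrite deltaE le_eqVlt; apply/orP; left; apply/eqP; ring.
have beta_le : beta * (2 * nu + 4 * q) <= 1.
  rewrite -(ler_pM2r r0) mul1r; apply: le_trans betaRad.
  by rewrite mulrAC ler_pM2r ?ler_pM2l//; lra.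
(* The distance to [xbar] is at most [beta * r + 2 * beta * Rad <= 3 * beta * Rad], below [r]
   because [2 * nu + 4 * q >= 6]. Going past [1 + beta] makes all points up to [1 + beta]
   interior. *)
have K2 : K (x + (1 + 2 * beta) *: h).
  apply: inner; rewrite /eball/closed_ball_/=.
  have -> : xbar - (x + (1 + 2 * beta) *: h) = (z - x) - (2 * beta) *: h.
    by apply/rowP => i; rewrite !mxE; ring.
  apply: le_trans (ler_enormD _ _) _; rewrite enormN enormZ -/delta.
  rewrite gtr0_norm ?mulr_gt0//.
  have : 2 * beta * enorm h <= 2 * beta * Rad by rewrite ler_pM2l// mulr_gt0.
  have : beta * r <= beta * Rad by rewrite ler_pM2l.
  have : 0 < beta * Rad by rewrite mulr_gt0// (lt_le_trans r0).
  rewrite deltaE; nra.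
have -> : r / (2 * delta) = (2 * beta)^-1.
  by rewrite deltaE; field; rewrite !gt_eqF.
apply: (barrier_slope_le scb Kx beta0) => [||t /andP[t0 t1]].
- by rewrite -/q; lra.
(* [z] is the convex combination of [x - beta *: h] and [y] with weights [1 / (1 + beta)] and
   [beta / (1 + beta)], so it would be interior too. *)
- move=> Kw; apply: nKz.
  have := convex_set_interior (scb_convex_set scb) Kw (inner _ Ky)
    (s := beta / (1 + beta)).
  have b1 : 0 < 1 + beta by lra.
  rewrite divr_ge0 ?(ltW beta0) ?(ltW b1)//= ltr_pdivrMr// mul1r.
  rewrite ltrDr ltr01 => /(_ isT); congr (K° _).
  by apply/rowP => i; rewrite !mxE; field; rewrite !gt_eqF.
- have b2 : 0 < 1 + 2 * beta by lra.
  have := convex_set_interior (scb_convex_set scb) Kx K2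
    (s := t / (1 + 2 * beta)).
  rewrite divr_ge0 ?(ltW b2)//= ltr_pdivrMr// mul1r.
  have -> : t < 1 + 2 * beta by lra.
  move=> /(_ isT); congr (K° _).
  by apply/rowP => i; rewrite !mxE; field; rewrite gt_eqF.
Qed.

Theorem lemmaB11 (R : realType) (n : nat) (K : set 'rV[R]_n)
    (q phi : 'rV[R]_n -> R) (nu r Rad eta : R) (xbar xeta : 'rV[R]_n)
    (polytopeK : polytope K)
    (diff_q : forall x, differentiable q x)
    (convex_q : convex_function setT q)
    (scb_phi : self_concordant_barrier nu K phi)
    (r_gt0 : 0 < r) (Rad_gt0 : 0 < Rad)
    (inner_ball : eball xbar r `<=` K)
    (outer_ball : K `<=` eball xbar Rad)
    (eta_gt0 : 0 < eta)
    (argmin_xeta : is_argmin K° (fun x => q x + eta * phi x) xeta) :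
  eball xeta
    (r / Rad *
     (if gradient q xeta == 0 then r / (2 * nu + 4 * Num.sqrt nu)
      else Num.min (eta / (2 * enorm (gradient q xeta)))
                   (r / (2 * nu + 4 * Num.sqrt nu))))
  `<=` K.
Proof.
move=> p xp; apply: contrapT => nKp.
have [Kx _] := argmin_xeta.
have [z [Kz nKz] zp] := boundary_on_segment (scb_closed scb_phi) Kx nKp.
move: xp; rewrite /eball/closed_ball_/= -opprB enormN => /(lt_le_trans zp).
set delta := enorm (z - xeta).
set M := 2 * nu + 4 * Num.sqrt nu; set G := gradient q xeta => delta_lt.
have nu1 := scb_nu_ge1 scb_phi.
have M0 : 0 < M by rewrite /M ltr_pwDl ?mulr_ge0 ?sqrtr_ge0//; lra.
have rR0 : 0 < r / Rad by rewrite divr_gt0.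
(* Valid whether or not [G] vanishes; this is the smallness condition of [slope_towards_center]. *)
have delta_M : delta < r / Rad * (r / M).
  apply: lt_le_trans delta_lt _; rewrite ler_pM2l//.
  by case: ifP => // _; rewrite ge_min lexx orbT.
have slope : 'D_(xbar - z) phi xeta <= - (r / (2 * delta)).
  apply: (slope_towards_center scb_phi r_gt0 inner_ball outer_ball) => //.
  rewrite -/delta -/M -ler_pdivlMr ?mulr_gt0//; apply: ltW.
  by apply: lt_le_trans delta_M _; rewrite mulf_div expr2.
have delta0 : 0 < delta.
  rewrite lt_neqAle enorm_ge0 andbT eq_sym; apply/eqP => /enorm_eq0/eqP.
  by rewrite subr_eq0 => /eqP zx; apply: nKz; rewrite zx.
have dq y h : is_derive y h q ('D_h q y) by apply/derivableP/diff_derivable.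
have dF y h : K° y -> is_derive y h (fun x => q x + eta * phi x)
    ('D_h q y + eta * 'D_h phi y).
  by move=> Ky; apply: is_deriveD; apply: is_deriveZ; exact: (barrier_is_derive1 scb_phi).
(* Stationarity trades the slope of [phi] towards the centre for the slope of [q], which
   Cauchy-Schwarz bounds by [enorm G * Rad]. *)
have stationary : 'D_(xbar - z) q xeta + eta * 'D_(xbar - z) phi xeta = 0.
  rewrite -(@derive_val _ _ _ _ _ _ _ (dF _ (xbar - z) Kx)).
  apply: derive_argmin argmin_xeta; first exact: open_interior.
  by move=> y Ky; have [] := dF y (xbar - z) Ky.
have hRad : enorm (xbar - z) <= Rad by exact: outer_ball.
have Gh : 'D_(xbar - z) q xeta <= enorm G * Rad.
  rewrite derive_gradient//; apply: le_trans (cauchy_schwarz _ _) _.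
  by rewrite ler_wpM2l// enorm_ge0.
have {slope} Gdelta : eta * r <= 2 * delta * (enorm G * Rad).
  have : eta * (r / (2 * delta)) <= enorm G * Rad.
    apply: le_trans Gh.
    have -> : 'D_(xbar - z) q xeta = eta * - 'D_(xbar - z) phi xeta by lra.
    by rewrite ler_pM2l//; lra.
  by rewrite mulrA ler_pdivrMr ?mulr_gt0// [_ * (2 * _)]mulrC.
have etar0 : 0 < eta * r by rewrite mulr_gt0.
(* If [G = 0], then [Gdelta] reads [eta * r <= 0], which is absurd; otherwise it contradicts the
   first term of the minimum. *)
move: delta_lt; have [G0|G0] := eqVneq G 0.
  suff G00 : enorm G = 0 by move: Gdelta; rewrite G00 mul0r mulr0 leNgt etar0.
  by rewrite G0 -(scale0r G) enormZ normr0 mul0r.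
have Ggt0 : 0 < enorm G.
  by rewrite lt_neqAle enorm_ge0 andbT eq_sym; apply: contra_neq G0 => /enorm_eq0.
move=> delta_lt; have : delta < r / Rad * (eta / (2 * enorm G)).
  by apply: lt_le_trans delta_lt _; rewrite ler_pM2l// ge_min lexx.
rewrite mulf_div ltr_pdivlMr ?mulr_gt0//; lra.
Qed.
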